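(* Idempotent completion defines a 2-functor $\mathrm{Kar}:\mathbf{Cat}\to\mathbf{Cat}_{\mathrm{ic}}$ which is left adjoint (in the bicategorical sense) to the forgetful 2-functor $\mathcal{U}:\mathbf{Cat}_{\mathrm{ic}}\to\mathbf{Cat}$.
   Context: $\mathbf{Cat}$ is the 2-category of small categories and $\mathbf{Cat}_{\mathrm{ic}}$ its full sub-2-category on the idempotent complete categories, i.e. those in which every idempotent $p=p^2:A\to A$ splits (there are $f:A\to B$, $g:B\to A$ with $f\circ g=\mathrm{id}_B$, $g\circ f=p$). A 2-functor is a pseudofunctor between 2-categories whose coherence 2-morphisms are identities. For a category $\mathcal{C}$, the idempotent completion $\mathrm{Kar}(\mathcal{C})$ has as objects pairs $A_p$ of an object $A$ and an idempotent $p:A\to A$ in $\mathcal{C}$; a morphism $A_p\to B_q$ is a morphism $f:A\to B$ in $\mathcal{C}$ with $f\circ p=f$ and $q\circ f=f$; composition is that of $\mathcal{C}$, and the identity of $A_p$ is $p$. On a functor $F:\mathcal{C}\to\mathcal{D}$, $\mathrm{Kar}(F)$ sends $A_p$ to $(FA)_{Fp}$ and $f$ to $Ff$; on a natural transformation $\varphi:F\to G$, $\mathrm{Kar}(\varphi)_{A_p}=G(p)\circ\varphi_A=\varphi_A\circ F(p)$. Adjoint pseudofunctors: pseudofunctors $F:\mathbb{B}\to\mathbb{C}$ and $G:\mathbb{C}\to\mathbb{B}$ between bicategories are adjoint, with $F$ left adjoint to $G$, if there exist strong transformations (i.e. pseudonatural transformations with invertible coherence 2-morphisms) $\eta:\mathrm{id}_{\mathbb{B}}\to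 GF$, $\epsilon:FG\to\mathrm{id}_{\mathbb{C}}$ and invertible modifications $\Gamma:\mathrm{id}_F\to(\epsilon F)\circ(F\eta)$ and $\Lambda:(G\epsilon)\circ(\eta G)\to\mathrm{id}_G$. *)

(* Defs.v *)
(* Plain Rocq with the Stdlib axioms of functional extensionality and proof
   irrelevance.  The latter entails uniqueness of identity proofs, so every
   type is a set up to Leibniz equality, and Leibniz equality is the equality
   of objects, morphisms, functors and natural transformations below. *)
From Stdlib Require Import FunctionalExtensionality ProofIrrelevance.

Set Implicit Arguments.
Unset Strict Implicit.
Unset Printing Implicit Defensive.

Declare Scope bicat_scope.
Open Scope bicat_scope.

(* Objects and morphisms live in one and the same universe once [Cat] is
   formed: these are the small categories. *)
Record Category := {
  ob :> Type;
  Hom : ob -> ob -> Type;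
  idn : forall a, Hom a a;
  cmp : forall a b c, Hom b c -> Hom a b -> Hom a c;
  cmp_idl : forall a b (f : Hom a b), cmp (idn b) f = f;
  cmp_idr : forall a b (f : Hom a b), cmp f (idn a) = f;
  cmp_assoc : forall a b c d (h : Hom c d) (g : Hom b c) (f : Hom a b),
    cmp (cmp h g) f = cmp h (cmp g f) }.
Arguments Hom {_} _ _.
Arguments idn {_} a.
Arguments cmp {_ a b c} _ _.

Notation "g ∘ f" := (cmp g f) (at level 40, left associativity) : bicat_scope.

Record Iso (C : Category) (a b : C) := {
  iso_mor :> Hom a b;
  iso_inv : Hom b a;
  iso_invK : iso_inv ∘ iso_mor = idn a;
  iso_morK : iso_mor ∘ iso_inv = idn b }.

Definition is_iso (C : Category) (a b : C) (f : Hom a b) : Prop :=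
  exists g : Hom b a, g ∘ f = idn a /\ f ∘ g = idn b.

(* Source and target need not be syntactically equal, e.g. for an associator
   [(h ⊚ g) ⊚ f --> h ⊚ (g ⊚ f)] which is the identity of a strict
   composite. *)
Definition is_identity (C : Category) (a b : C) (f : Hom a b) : Prop :=
  exists e : a = b, f = match e in _ = c return Hom a c with eq_refl => idn a end.

Set Primitive Projections.
Record FunctorData (C D : Category) := {
  fobj : C -> D;
  fmor : forall a b : C, Hom a b -> Hom (fobj a) (fobj b) }.
Unset Primitive Projections.
Arguments fmor {C D} _ {a b} _.

Record is_functor (C D : Category) (F : FunctorData C D) : Prop := {
  fmor_idn : forall a : C, fmor F (idn a) = idn (fobj F a);
  fmor_cmp : forall (a b c : C) (g : Hom b c) (f : Hom a b),
    fmor F (g ∘ f) = fmor F g ∘ fmor F f }.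

Record Functor (C D : Category) := {
  functor_data :> FunctorData C D;
  functorP : is_functor functor_data }.

Record NatTrans (C D : Category) (F G : Functor C D) := {
  ntc :> forall a : C, Hom (fobj F a) (fobj G a);
  nt_natural : forall (a b : C) (f : Hom a b),
    fmor G f ∘ ntc a = ntc b ∘ fmor F f }.

Lemma NatTrans_eq (C D : Category) (F G : Functor C D) (s t : NatTrans F G) :
  (forall a, s a = t a) -> s = t.
Proof.
  destruct s as [s hs], t as [t ht]; simpl; intros H.
  assert (e : s = t) by (apply functional_extensionality_dep; exact H).
  subst t; f_equal; apply proof_irrelevance.
Qed.

Lemma Functor_eq (C D : Category) (F G : Functor C D) :
  functor_data F = functor_data G -> F = G.
Proof.
  destruct F as [F hF], G as [G hG]; simpl; intros e.
  subst G; f_equal; apply proof_irrelevance.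
Qed.

Definition ProdCat (C D : Category) : Category.
Proof.
  refine {| ob := C * D;
            Hom x y := (Hom (fst x) (fst y) * Hom (snd x) (snd y))%type;
            idn x := (idn (fst x), idn (snd x));
            cmp x y z g f := (fst g ∘ fst f, snd g ∘ snd f) |}.
  - intros a b [f g]; simpl; f_equal; apply cmp_idl.
  - intros a b [f g]; simpl; f_equal; apply cmp_idr.
  - intros; f_equal; apply cmp_assoc.
Defined.

Record BicatData := {
  bob :> Type;
  bhom : bob -> bob -> Category;
  bid : forall X, bhom X X;
  bcomp : forall X Y Z, Functor (ProdCat (bhom Y Z) (bhom X Y)) (bhom X Z) }.
Arguments bhom {_} _ _.
Arguments bid {_} X.
Arguments bcomp {_} X Y Z.

Definition hcomp1 (B : BicatData) (X Y Z : B) (g : bhom Y Z) (f : bhom X Y) :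
  bhom X Z := fobj (bcomp X Y Z) (g, f).

Definition hcomp2 (B : BicatData) (X Y Z : B) (g g' : bhom Y Z)
    (f f' : bhom X Y) (β : Hom g g') (α : Hom f f') :
    Hom (hcomp1 g f) (hcomp1 g' f') :=
  fmor (bcomp X Y Z) (a := (g, f)) (b := (g', f')) (β, α).

Notation "g ⊚ f" := (hcomp1 g f) (at level 35, right associativity) : bicat_scope.
Notation "β ⋆ α" := (hcomp2 β α) (at level 35, right associativity) : bicat_scope.

Lemma hcomp2_idn (B : BicatData) (X Y Z : B) (g : bhom Y Z) (f : bhom X Y) :
  idn g ⋆ idn f = idn (g ⊚ f).
Proof. exact (fmor_idn (functorP (bcomp X Y Z)) (g, f)). Qed.

Lemma hcomp2_cmp (B : BicatData) (X Y Z : B) (g g' g'' : bhom Y Z)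
    (f f' f'' : bhom X Y) (β' : Hom g' g'') (β : Hom g g')
    (α' : Hom f' f'') (α : Hom f f') :
  (β' ∘ β) ⋆ (α' ∘ α) = (β' ⋆ α') ∘ (β ⋆ α).
Proof.
  exact (fmor_cmp (functorP (bcomp X Y Z)) (a := (g, f)) (b := (g', f'))
           (c := (g'', f'')) (β', α') (β, α)).
Qed.

Record Bicategory := {
  bdata :> BicatData;
  bassoc : forall (X Y Z W : bdata)
      (h : bhom Z W) (g : bhom Y Z) (f : bhom X Y),
    Iso ((h ⊚ g) ⊚ f) (h ⊚ (g ⊚ f));
  blunit : forall (X Y : bdata) (f : bhom X Y), Iso (bid Y ⊚ f) f;
  brunit : forall (X Y : bdata) (f : bhom X Y), Iso (f ⊚ bid X) f;
  bassoc_natural : forall (X Y Z W : bdata) (h h' : bhom Z W)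
      (g g' : bhom Y Z) (f f' : bhom X Y)
      (γ : Hom h h') (β : Hom g g') (α : Hom f f'),
    bassoc h' g' f' ∘ ((γ ⋆ β) ⋆ α) = (γ ⋆ (β ⋆ α)) ∘ bassoc h g f;
  blunit_natural : forall (X Y : bdata) (f f' : bhom X Y) (α : Hom f f'),
    blunit f' ∘ (idn (bid Y) ⋆ α) = α ∘ blunit f;
  brunit_natural : forall (X Y : bdata) (f f' : bhom X Y) (α : Hom f f'),
    brunit f' ∘ (α ⋆ idn (bid X)) = α ∘ brunit f;
  bpentagon : forall (X Y Z W V : bdata)
      (k : bhom W V) (h : bhom Z W) (g : bhom Y Z) (f : bhom X Y),
    bassoc k h (g ⊚ f) ∘ bassoc (k ⊚ h) g f
    = (idn k ⋆ bassoc h g f) ∘ bassoc k (h ⊚ g) f ∘ (bassoc k h g ⋆ idn f);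
  btriangle : forall (X Y Z : bdata) (g : bhom Y Z) (f : bhom X Y),
    (idn g ⋆ blunit f) ∘ bassoc g (bid Y) f = brunit g ⋆ idn f }.
Arguments bassoc {_ X Y Z W} h g f.
Arguments blunit {_ X Y} f.
Arguments brunit {_ X Y} f.

Record TwoCategory := {
  two_bicat :> Bicategory;
  two_assoc : forall (X Y Z W : two_bicat)
      (h : bhom Z W) (g : bhom Y Z) (f : bhom X Y), is_identity (bassoc h g f);
  two_lunit : forall (X Y : two_bicat) (f : bhom X Y), is_identity (blunit f);
  two_runit : forall (X Y : two_bicat) (f : bhom X Y), is_identity (brunit f) }.

(* The action on cells is separated from the coherence data, with primitive
   projections, so that composition of such actions is associative and unital
   up to conversion. *)
Set Primitive Projections.
Record PMap (B C : Bicategory) := {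
  pob : B -> C;
  p1 : forall X Y : B, bhom X Y -> bhom (pob X) (pob Y);
  p2 : forall (X Y : B) (f g : bhom X Y), Hom f g -> Hom (p1 f) (p1 g) }.
Unset Primitive Projections.
Arguments p1 {B C} _ {X Y} _.
Arguments p2 {B C} _ {X Y f g} _.

Record Pseudofunctor (B C : Bicategory) := {
  pmap :> PMap B C;
  p2_idn : forall (X Y : B) (f : bhom X Y), p2 pmap (idn f) = idn (p1 pmap f);
  p2_cmp : forall (X Y : B) (f g h : bhom X Y) (β : Hom g h) (α : Hom f g),
    p2 pmap (β ∘ α) = p2 pmap β ∘ p2 pmap α;
  pcomp : forall (X Y Z : B) (g : bhom Y Z) (f : bhom X Y),
    Iso (p1 pmap g ⊚ p1 pmap f) (p1 pmap (g ⊚ f));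
  punit : forall X : B, Iso (bid (pob pmap X)) (p1 pmap (bid X));
  pcomp_natural : forall (X Y Z : B) (g g' : bhom Y Z) (f f' : bhom X Y)
      (β : Hom g g') (α : Hom f f'),
    pcomp g' f' ∘ (p2 pmap β ⋆ p2 pmap α) = p2 pmap (β ⋆ α) ∘ pcomp g f;
  pcomp_assoc : forall (X Y Z W : B)
      (h : bhom Z W) (g : bhom Y Z) (f : bhom X Y),
    p2 pmap (bassoc h g f) ∘ pcomp (h ⊚ g) f ∘ (pcomp h g ⋆ idn (p1 pmap f))
    = pcomp h (g ⊚ f) ∘ (idn (p1 pmap h) ⋆ pcomp g f)
      ∘ bassoc (p1 pmap h) (p1 pmap g) (p1 pmap f);
  pcomp_lunit : forall (X Y : B) (f : bhom X Y),
    p2 pmap (blunit f) ∘ pcomp (bid Y) f ∘ (punit Y ⋆ idn (p1 pmap f))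
    = blunit (p1 pmap f);
  pcomp_runit : forall (X Y : B) (f : bhom X Y),
    p2 pmap (brunit f) ∘ pcomp f (bid X) ∘ (idn (p1 pmap f) ⋆ punit X)
    = brunit (p1 pmap f) }.
Arguments pcomp {B C} _ {X Y Z} g f.
Arguments punit {B C} _ X.

Record TwoFunctor (B C : TwoCategory) := {
  two_pseudo :> Pseudofunctor B C;
  two_pcomp : forall (X Y Z : B) (g : bhom Y Z) (f : bhom X Y),
    is_identity (pcomp two_pseudo g f);
  two_punit : forall X : B, is_identity (punit two_pseudo X) }.

Definition iso_id (C : Category) (a : C) : Iso a a.
Proof. refine {| iso_mor := idn a; iso_inv := idn a |}; apply cmp_idl. Defined.

Definition iso_comp (C : Category) (a b c : C) (g : Iso b c) (f : Iso a b) :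
  Iso a c.
Proof.
  refine {| iso_mor := g ∘ f; iso_inv := iso_inv f ∘ iso_inv g |}.
  - rewrite cmp_assoc, <- (cmp_assoc (iso_inv g)), iso_invK, cmp_idl.
    apply iso_invK.
  - rewrite cmp_assoc, <- (cmp_assoc f), iso_morK, cmp_idl.
    apply iso_morK.
Defined.

Definition iso_sym (C : Category) (a b : C) (f : Iso a b) : Iso b a.
Proof.
  refine {| iso_mor := iso_inv f; iso_inv := iso_mor f |};
    [apply iso_morK | apply iso_invK].
Defined.

Definition iso_hcomp (B : Bicategory) (X Y Z : B) (g g' : bhom Y Z)
    (f f' : bhom X Y) (β : Iso g g') (α : Iso f f') : Iso (g ⊚ f) (g' ⊚ f').
Proof.
  refine {| iso_mor := β ⋆ α; iso_inv := iso_inv β ⋆ iso_inv α |}.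
  - rewrite <- hcomp2_cmp, !iso_invK; apply hcomp2_idn.
  - rewrite <- hcomp2_cmp, !iso_morK; apply hcomp2_idn.
Defined.

Definition iso_p2 (B C : Bicategory) (F : Pseudofunctor B C) (X Y : B)
    (f g : bhom X Y) (α : Iso f g) : Iso (p1 F f) (p1 F g).
Proof.
  refine {| iso_mor := p2 F α; iso_inv := p2 F (iso_inv α) |}.
  - rewrite <- p2_cmp, iso_invK; apply p2_idn.
  - rewrite <- p2_cmp, iso_morK; apply p2_idn.
Defined.

Definition id_pmap (B : Bicategory) : PMap B B :=
  {| pob X := X; p1 X Y f := f; p2 X Y f g α := α |}.

Definition id_pseudo (B : Bicategory) : Pseudofunctor B B.
Proof.
  refine {| pmap := id_pmap B;
            pcomp X Y Z g f := iso_id (g ⊚ f);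
            punit X := iso_id (bid X) |}; simpl; intros.
  - reflexivity.
  - reflexivity.
  - rewrite cmp_idl, cmp_idr; reflexivity.
  - rewrite !hcomp2_idn, !cmp_idr, !cmp_idl; reflexivity.
  - rewrite hcomp2_idn, !cmp_idr; reflexivity.
  - rewrite hcomp2_idn, !cmp_idr; reflexivity.
Defined.

Definition comp_pmap (B C D : Bicategory) (G : PMap C D) (F : PMap B C) :
    PMap B D :=
  {| pob X := pob G (pob F X);
     p1 X Y f := p1 G (p1 F f);
     p2 X Y f g α := p2 G (p2 F α) |}.

Definition comp_pseudo (B C D : Bicategory) (G : Pseudofunctor C D)
    (F : Pseudofunctor B C) : Pseudofunctor B D.
Proof.
  refine {| pmap := comp_pmap G F;
            pcomp X Y Z g f :=
              iso_comp (iso_p2 G (pcomp F g f)) (pcomp G (p1 F g) (p1 F f));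
            punit X :=
              iso_comp (iso_p2 G (punit F X)) (punit G (pob F X)) |};
    simpl; intros.
  - rewrite !p2_idn; reflexivity.
  - rewrite !p2_cmp; reflexivity.
  - rewrite cmp_assoc, pcomp_natural, <- cmp_assoc, <- p2_cmp, pcomp_natural.
    rewrite p2_cmp, cmp_assoc; reflexivity.
  - pose proof (f_equal (fun x => p2 G x) (pcomp_assoc F h g f)) as E.
    simpl in E; rewrite !p2_cmp in E.
    pose proof (pcomp_natural G (pcomp F h g) (idn (p1 F f))) as N1.
    pose proof (pcomp_natural G (idn (p1 F h)) (pcomp F g f)) as N2.
    rewrite p2_idn in N1, N2.
    rewrite <- (cmp_idl (idn (p1 G (p1 F f)))).
    rewrite <- (cmp_idl (idn (p1 G (p1 F h)))).
    rewrite !hcomp2_cmp, <- !cmp_assoc.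
    rewrite (cmp_assoc _ (pcomp G _ _) (p2 G _ ⋆ _)), N1.
    rewrite <- !cmp_assoc, E.
    rewrite !(cmp_assoc _ (pcomp G _ _) (idn _ ⋆ _)), !N2.
    pose proof (pcomp_assoc G (p1 F h) (p1 F g) (p1 F f)) as E'.
    rewrite !cmp_assoc in E' |- *; rewrite E', !cmp_assoc; reflexivity.
  - pose proof (f_equal (fun x => p2 G x) (pcomp_lunit F f)) as E.
    simpl in E; rewrite !p2_cmp in E.
    pose proof (pcomp_natural G (punit F Y) (idn (p1 F f))) as N1.
    rewrite p2_idn in N1.
    rewrite <- (cmp_idl (idn (p1 G (p1 F f)))).
    rewrite hcomp2_cmp, <- !cmp_assoc.
    rewrite (cmp_assoc _ (pcomp G _ _) (p2 G _ ⋆ _)), N1.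
    rewrite <- !cmp_assoc, E; apply pcomp_lunit.
  - pose proof (f_equal (fun x => p2 G x) (pcomp_runit F f)) as E.
    simpl in E; rewrite !p2_cmp in E.
    pose proof (pcomp_natural G (idn (p1 F f)) (punit F X)) as N1.
    rewrite p2_idn in N1.
    rewrite <- (cmp_idl (idn (p1 G (p1 F f)))).
    rewrite hcomp2_cmp, <- !cmp_assoc.
    rewrite (cmp_assoc _ (pcomp G _ _) (_ ⋆ p2 G _)), N1.
    rewrite <- !cmp_assoc, E; apply pcomp_runit.
Defined.

Record TransData (B C : Bicategory) (F G : PMap B C) := {
  tr1 : forall X : B, bhom (pob F X) (pob G X);
  tr2 : forall (X Y : B) (f : bhom X Y),
    Iso (p1 G f ⊚ tr1 X) (tr1 Y ⊚ p1 F f) }.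
Arguments tr1 {B C F G} _ X.
Arguments tr2 {B C F G} _ {X Y} f.

Record StrongTrans (B C : Bicategory) (F G : Pseudofunctor B C) := {
  trans :> TransData F G;
  trans_natural : forall (X Y : B) (f g : bhom X Y) (α : Hom f g),
    tr2 trans g ∘ (p2 G α ⋆ idn (tr1 trans X))
    = (idn (tr1 trans Y) ⋆ p2 F α) ∘ tr2 trans f;
  trans_unit : forall X : B,
    tr2 trans (bid X) ∘ (punit G X ⋆ idn (tr1 trans X))
    = (idn (tr1 trans X) ⋆ punit F X)
      ∘ iso_inv (brunit (tr1 trans X)) ∘ blunit (tr1 trans X);
  trans_comp : forall (X Y Z : B) (g : bhom Y Z) (f : bhom X Y),
    tr2 trans (g ⊚ f) ∘ (pcomp G g f ⋆ idn (tr1 trans X))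
    = (idn (tr1 trans Z) ⋆ pcomp F g f)
      ∘ bassoc (tr1 trans Z) (p1 F g) (p1 F f)
      ∘ (tr2 trans g ⋆ idn (p1 F f))
      ∘ iso_inv (bassoc (p1 G g) (tr1 trans Y) (p1 F f))
      ∘ (idn (p1 G g) ⋆ tr2 trans f)
      ∘ bassoc (p1 G g) (p1 G f) (tr1 trans X) }.

(* The modification axiom only involves the cells of the two transformations
   and the actions of the pseudofunctors on cells, so modifications, and the
   identity, composite and whiskered transformations, are defined on
   [TransData].  Since [F ∘ (G ∘ F)] and [(F ∘ G) ∘ F], as well as [F ∘ id] and
   [id ∘ F], have convertible actions on cells, the composite [(ε F) (F η)] of
   the adjunction data makes sense without inserted associators. *)
Record Modification (B C : Bicategory) (F G : PMap B C) (σ τ : TransData F G) := {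
  mod_cell :> forall X : B, Hom (tr1 σ X) (tr1 τ X);
  mod_natural : forall (X Y : B) (f : bhom X Y),
    tr2 τ f ∘ (idn (p1 G f) ⋆ mod_cell X)
    = (mod_cell Y ⋆ idn (p1 F f)) ∘ tr2 σ f }.

Definition invertible_mod (B C : Bicategory) (F G : PMap B C)
    (σ τ : TransData F G) (Γ : Modification σ τ) : Prop :=
  forall X : B, is_iso (Γ X).

Definition id_trans (B C : Bicategory) (F : PMap B C) : TransData F F :=
  {| tr1 X := bid (pob F X);
     tr2 X Y f := iso_comp (iso_sym (blunit (p1 F f))) (brunit (p1 F f)) |}.

(* [tr2] is the pasting
   Hf (τ σ) -> (Hf τ) σ -> (τ Gf) σ -> τ (Gf σ) -> τ (σ Ff) -> (τ σ) Ff. *)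
Definition comp_trans (B C : Bicategory) (F G H : PMap B C)
    (τ : TransData G H) (σ : TransData F G) : TransData F H :=
  {| tr1 X := tr1 τ X ⊚ tr1 σ X;
     tr2 X Y f :=
       iso_comp (iso_sym (bassoc (tr1 τ Y) (tr1 σ Y) (p1 F f)))
      (iso_comp (iso_hcomp (iso_id (tr1 τ Y)) (tr2 σ f))
      (iso_comp (bassoc (tr1 τ Y) (p1 G f) (tr1 σ X))
      (iso_comp (iso_hcomp (tr2 τ f) (iso_id (tr1 σ X)))
                (iso_sym (bassoc (p1 H f) (tr1 τ X) (tr1 σ X)))))) |}.

Definition prewhisker (A B C : Bicategory) (F G : PMap B C)
    (σ : TransData F G) (K : PMap A B) :
    TransData (comp_pmap F K) (comp_pmap G K) :=
  @Build_TransData A C (comp_pmap F K) (comp_pmap G K)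
    (fun X => tr1 σ (pob K X)) (fun X Y f => tr2 σ (p1 K f)).

Definition postwhisker (B C D : Bicategory) (K : Pseudofunctor C D)
    (F G : PMap B C) (σ : TransData F G) :
    TransData (comp_pmap K F) (comp_pmap K G) :=
  @Build_TransData B D (comp_pmap K F) (comp_pmap K G)
    (fun X => p1 K (tr1 σ X))
    (fun X Y f =>
       iso_comp (iso_sym (pcomp K (tr1 σ Y) (p1 F f)))
      (iso_comp (iso_p2 K (tr2 σ f))
                (pcomp K (p1 G f) (tr1 σ X)))).

Definition left_adjoint (B C : Bicategory) (F : Pseudofunctor B C)
    (G : Pseudofunctor C B) : Prop :=
  exists (η : StrongTrans (id_pseudo B) (comp_pseudo G F))
         (ε : StrongTrans (comp_pseudo F G) (id_pseudo C))
         (Γ : @Modification B C F F (id_trans F)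
                (comp_trans (prewhisker ε F) (postwhisker F η)))
         (Λ : @Modification C B G G
                (comp_trans (postwhisker G ε) (prewhisker η G))
                (id_trans G)),
    invertible_mod Γ /\ invertible_mod Λ.

Definition id_functor (C : Category) : Functor C C.
Proof.
  exists {| fobj a := a; fmor a b f := f |}.
  split; reflexivity.
Defined.

Definition comp_functor (C D E : Category) (G : Functor D E) (F : Functor C D) :
  Functor C E.
Proof.
  exists {| fobj a := fobj G (fobj F a); fmor a b f := fmor G (fmor F f) |}.
  destruct F as [F [F1 F2]], G as [G [G1 G2]]; split; simpl; intros.
  - rewrite F1; apply G1.
  - rewrite F2; apply G2.
Defined.

Definition id_nat (C D : Category) (F : Functor C D) : NatTrans F F.
Proof.
  exists (fun a => idn (fobj F a)).
  intros; rewrite cmp_idl; apply cmp_idr.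
Defined.

Definition comp_nat (C D : Category) (F G H : Functor C D)
    (t : NatTrans G H) (s : NatTrans F G) : NatTrans F H.
Proof.
  exists (fun a => t a ∘ s a).
  intros; rewrite <- cmp_assoc, nt_natural, !cmp_assoc, nt_natural; reflexivity.
Defined.

Definition FunCat (C D : Category) : Category.
Proof.
  refine {| ob := Functor C D; Hom := @NatTrans C D; idn := @id_nat C D;
            cmp := @comp_nat C D |};
    intros; apply NatTrans_eq; intros x; simpl.
  - apply cmp_idl.
  - apply cmp_idr.
  - apply cmp_assoc.
Defined.

Definition hcomp_nat (C D E : Category) (G G' : Functor D E) (F F' : Functor C D)
    (t : NatTrans G G') (s : NatTrans F F') :
    NatTrans (comp_functor G F) (comp_functor G' F').
Proof.
  exists (fun a => t (fobj F' a) ∘ fmor G (s a)).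
  intros a b f; simpl.
  rewrite <- cmp_assoc, nt_natural, !cmp_assoc.
  rewrite <- !(fmor_cmp (functorP G)), nt_natural; reflexivity.
Defined.

Definition comp_bifunctor (C D E : Category) :
  Functor (ProdCat (FunCat D E) (FunCat C D)) (FunCat C E).
Proof.
  exists (@Build_FunctorData (ProdCat (FunCat D E) (FunCat C D)) (FunCat C E)
            (fun x => comp_functor (fst x) (snd x))
            (fun x y t => hcomp_nat (fst t) (snd t))).
  split.
  - intros [G F]; apply NatTrans_eq; intros a; simpl.
    rewrite (fmor_idn (functorP G)); apply cmp_idl.
  - intros [G F] [G' F'] [G'' F''] [t' s'] [t s].
    apply NatTrans_eq; intros a; simpl in *.
    rewrite (fmor_cmp (functorP G)), !cmp_assoc; f_equal.
    rewrite <- !cmp_assoc, nt_natural; reflexivity.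
Defined.

Definition same_data_nat (C D : Category) (F : FunctorData C D)
    (h h' : is_functor F) : NatTrans (Build_Functor h) (Build_Functor h').
Proof.
  exists (fun a => idn (fobj F a)).
  intros; simpl; rewrite cmp_idl; apply cmp_idr.
Defined.

Definition same_data_iso (C D : Category) (F : FunctorData C D)
    (h h' : is_functor F) :
    @Iso (FunCat C D) (Build_Functor h) (Build_Functor h').
Proof.
  exists (same_data_nat h h' : @Hom (FunCat C D) _ _)
         (same_data_nat h' h : @Hom (FunCat C D) _ _);
    apply NatTrans_eq; intros a; simpl; apply cmp_idl.
Defined.

Lemma same_data_is_identity (C D : Category) (F : FunctorData C D)
    (h h' : is_functor F) : is_identity (same_data_iso h h').
Proof.
  assert (e : h = h') by apply proof_irrelevance; subst h'.
  exists eq_refl; apply NatTrans_eq; reflexivity.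
Qed.

Definition Cat_assoc (A B C D : Category) (H : Functor C D) (G : Functor B C)
    (F : Functor A B) :
    @Iso (FunCat A D) (comp_functor (comp_functor H G) F)
                      (comp_functor H (comp_functor G F)) :=
  same_data_iso (functorP (comp_functor (comp_functor H G) F))
                (functorP (comp_functor H (comp_functor G F))).

Definition Cat_lunit (A B : Category) (F : Functor A B) :
    @Iso (FunCat A B) (comp_functor (id_functor B) F) F :=
  match F return @Iso (FunCat A B) (comp_functor (id_functor B) F) F with
  | Build_Functor h =>
      same_data_iso
        (functorP (comp_functor (id_functor B) (Build_Functor h))) h
  end.

Definition Cat_runit (A B : Category) (F : Functor A B) :
    @Iso (FunCat A B) (comp_functor F (id_functor A)) F :=
  match F return @Iso (FunCat A B) (comp_functor F (id_functor A)) F with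
  | Build_Functor h =>
      same_data_iso
        (functorP (comp_functor (Build_Functor h) (id_functor A))) h
  end.

Definition Cat_data : BicatData :=
  {| bob := Category; bhom := FunCat; bid := id_functor;
     bcomp := comp_bifunctor |}.

Definition Cat_bicat : Bicategory.
Proof.
  refine {| bdata := Cat_data; bassoc := Cat_assoc;
            blunit := Cat_lunit; brunit := Cat_runit |};
    intros; apply NatTrans_eq; intros a.
  - simpl; rewrite cmp_idl, cmp_idr.
    rewrite (fmor_cmp (functorP h)), cmp_assoc; reflexivity.
  - destruct f as [f hf], f' as [f' hf']; simpl.
    rewrite !cmp_idl, cmp_idr; reflexivity.
  - destruct f as [f hf], f' as [f' hf']; simpl.
    rewrite (fmor_idn hf), !cmp_idl; reflexivity.
  - simpl.
    rewrite (fmor_idn (functorP g)), (fmor_idn (functorP h)), !cmp_idl.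
    rewrite !(fmor_idn (functorP k)), !cmp_idl; reflexivity.
  - destruct f as [f hf], g as [g hg]; simpl.
    rewrite ?(fmor_idn hg), !cmp_idl; reflexivity.
Defined.

Definition Cat : TwoCategory.
Proof.
  exists Cat_bicat.
  - intros; apply same_data_is_identity.
  - intros X Y [f hf]; apply same_data_is_identity.
  - intros X Y [f hf]; apply same_data_is_identity.
Defined.

Definition full_sub_data (B : BicatData) (P : B -> Prop) : BicatData :=
  {| bob := {X : B | P X};
     bhom X Y := bhom (proj1_sig X) (proj1_sig Y);
     bid X := bid (proj1_sig X);
     bcomp X Y Z := bcomp (proj1_sig X) (proj1_sig Y) (proj1_sig Z) |}.

Definition full_sub_bicat (B : Bicategory) (P : B -> Prop) : Bicategory :=
  @Build_Bicategory (full_sub_data P)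
    (fun X Y Z W => @bassoc B _ _ _ _)
    (fun X Y => @blunit B _ _)
    (fun X Y => @brunit B _ _)
    (fun X Y Z W => @bassoc_natural B _ _ _ _)
    (fun X Y => @blunit_natural B _ _)
    (fun X Y => @brunit_natural B _ _)
    (fun X Y Z W V => @bpentagon B _ _ _ _ _)
    (fun X Y Z => @btriangle B _ _ _).

Definition full_sub (B : TwoCategory) (P : B -> Prop) : TwoCategory :=
  {| two_bicat := full_sub_bicat P;
     two_assoc X Y Z W := @two_assoc B _ _ _ _;
     two_lunit X Y := @two_lunit B _ _;
     two_runit X Y := @two_runit B _ _ |}.

Definition forget_pmap (B : TwoCategory) (P : B -> Prop) :
    PMap (full_sub P) B :=
  @Build_PMap (full_sub P) B (fun X => proj1_sig X) (fun X Y f => f)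
    (fun X Y f g α => α).

Definition forget_pseudo (B : TwoCategory) (P : B -> Prop) :
  Pseudofunctor (full_sub P) B.
Proof.
  refine (@Build_Pseudofunctor (full_sub P) B (forget_pmap P) _ _
    (fun X Y Z g f => iso_id (C := bhom (b := B) _ _) _)
    (fun X => iso_id (C := bhom (b := B) _ _) _) _ _ _ _); simpl; intros.
  - reflexivity.
  - reflexivity.
  - rewrite cmp_idl, cmp_idr; reflexivity.
  - rewrite !hcomp2_idn, !cmp_idr, !cmp_idl; reflexivity.
  - rewrite hcomp2_idn, !cmp_idr; reflexivity.
  - rewrite hcomp2_idn, !cmp_idr; reflexivity.
Defined.

Definition forget (B : TwoCategory) (P : B -> Prop) : TwoFunctor (full_sub P) B.
Proof.
  exists (forget_pseudo P); intros; exists eq_refl; reflexivity.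
Defined.

Definition idempotent_complete (C : Category) : Prop :=
  forall (A : C) (p : Hom A A), p ∘ p = p ->
    exists (B : C) (f : Hom A B) (g : Hom B A), f ∘ g = idn B /\ g ∘ f = p.

Definition Cat_ic : TwoCategory := full_sub (B := Cat) idempotent_complete.

Definition U : TwoFunctor Cat_ic Cat := forget (B := Cat) idempotent_complete.

Record KarOb (C : Category) := {
  kob : C;
  kidem : Hom kob kob;
  kidemP : kidem ∘ kidem = kidem }.

Definition KarHom (C : Category) (A B : KarOb C) : Type :=
  {f : Hom (kob A) (kob B) | f ∘ kidem A = f /\ kidem B ∘ f = f}.

Lemma KarHom_eq (C : Category) (A B : KarOb C) (f g : KarHom A B) :
  proj1_sig f = proj1_sig g -> f = g.
Proof.
  destruct f as [f hf], g as [g hg]; simpl; intros e.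
  subst g; f_equal; apply proof_irrelevance.
Qed.

Definition Kar_cmp (C : Category) (X Y Z : KarOb C) (g : KarHom Y Z)
  (f : KarHom X Y) : KarHom X Z.
Proof.
  exists (proj1_sig g ∘ proj1_sig f).
  destruct g as [g [g1 g2]], f as [f [f1 f2]]; simpl; split.
  - rewrite cmp_assoc, f1; reflexivity.
  - rewrite <- cmp_assoc, g2; reflexivity.
Defined.

Definition Kar (C : Category) : Category.
Proof.
  refine {| ob := KarOb C;
            Hom := @KarHom C;
            idn A := exist _ (kidem A) (conj (kidemP A) (kidemP A));
            cmp := @Kar_cmp C |};
    intros; apply KarHom_eq; simpl.
  - exact (proj2 (proj2_sig f)).
  - exact (proj1 (proj2_sig f)).
  - apply cmp_assoc.
Defined.

Definition Kar_fob (C D : Category) (F : Functor C D) (A : Kar C) : Kar D :=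
  @Build_KarOb D (fobj F (kob A)) (fmor F (kidem A))
    (eq_trans (eq_sym (fmor_cmp (functorP F) _ _))
              (f_equal (fmor F) (kidemP A))).

Definition Kar_fmor (C D : Category) (F : Functor C D) (A B : Kar C)
  (f : Hom A B) : Hom (Kar_fob F A) (Kar_fob F B).
Proof.
  exists (fmor F (proj1_sig f)).
  destruct f as [f [f1 f2]]; simpl.
  rewrite <- !(fmor_cmp (functorP F)), f1, f2; split; reflexivity.
Defined.

Definition Kar_functor (C D : Category) (F : Functor C D) :
  Functor (Kar C) (Kar D).
Proof.
  exists {| fobj := Kar_fob F; fmor := @Kar_fmor C D F |}.
  split; intros; apply KarHom_eq; simpl.
  - reflexivity.
  - apply (fmor_cmp (functorP F)).
Defined.

Definition Kar_ntc (C D : Category) (F G : Functor C D) (φ : NatTrans F G)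
  (A : Kar C) : Hom (Kar_fob F A) (Kar_fob G A).
Proof.
  exists (fmor G (kidem A) ∘ φ (kob A)); simpl; split.
  - rewrite cmp_assoc, <- nt_natural, <- cmp_assoc.
    rewrite <- (fmor_cmp (functorP G)), kidemP; reflexivity.
  - rewrite <- cmp_assoc, <- (fmor_cmp (functorP G)), kidemP; reflexivity.
Defined.

Definition Kar_nat (C D : Category) (F G : Functor C D) (φ : NatTrans F G) :
  NatTrans (Kar_functor F) (Kar_functor G).
Proof.
  exists (Kar_ntc φ).
  intros A B [f [f1 f2]]; apply KarHom_eq; simpl.
  rewrite <- cmp_assoc, <- (fmor_cmp (functorP G)), f1.
  rewrite cmp_assoc, <- nt_natural, <- cmp_assoc.
  rewrite <- (fmor_cmp (functorP G)), f2; reflexivity.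
Defined.

Definition Kar_pmap (Kar_ic : forall C : Category, idempotent_complete (Kar C)) :
    PMap Cat Cat_ic :=
  @Build_PMap Cat Cat_ic (fun C => exist _ (Kar C) (Kar_ic C))
    Kar_functor Kar_nat.

(* Main.v *)
(* The unit embeds [a] as [a_id]; the counit at an idempotent complete [C]
   sends [A_p] to a chosen splitting of [p].  Any two splittings of an idempotent
   are canonically isomorphic, and functors preserve splittings: this gives the
   naturality cells of the counit, and both triangle modifications, since [A_p]
   itself splits the image of [p] in [Kar C] and [a] splits [id_a]. *)
From Stdlib Require Import FunctionalExtensionality ProofIrrelevance.
From Stdlib Require Import IndefiniteDescription.
Require Import Defs.

Set Implicit Arguments.
Unset Strict Implicit.
Unset Printing Implicit Defensive.

(** * Pointwise isomorphisms and identities; idempotents in [Kar C] *)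

Definition nat_iso (C D : Category) (F G : Functor C D) (s : NatTrans F G)
    (t : forall a, Hom (fobj G a) (fobj F a))
    (ts : forall a, t a ∘ s a = idn (fobj F a))
    (st : forall a, s a ∘ t a = idn (fobj G a)) : @Iso (FunCat C D) F G.
Proof.
  assert (nt : forall (a b : C) (f : Hom a b), fmor F f ∘ t a = t b ∘ fmor G f).
  { intros a b f.
    (* Inserting [t b ∘ s b] on the left turns naturality of [s] into naturality of its pointwise
       inverse. *)
    rewrite <- (cmp_idl (fmor F f ∘ t a)), <- ts, cmp_assoc.
    rewrite <- (cmp_assoc (s b)), <- nt_natural, cmp_assoc, st, cmp_idr.
    reflexivity. }
  exists (s : @Hom (FunCat C D) F G)
         ({| ntc := t; nt_natural := nt |} : @Hom (FunCat C D) G F);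
    apply NatTrans_eq; [exact ts | exact st].
Defined.

Lemma iso_is_iso (C : Category) (a b : C) (f : Iso a b) : is_iso f.
Proof. exists (iso_inv f); split; [apply iso_invK | apply iso_morK]. Qed.

(** Equal objects pointwise give equal object maps; naturality against identity components then
    forces the morphism maps to agree. Uniqueness of identity proofs removes the transports. *)
Lemma NatTrans_is_identity (C D : Category) (F G : Functor C D)
    (s : NatTrans F G) :
  (forall a, is_identity (s a)) -> @is_identity (FunCat C D) F G s.
Proof.
  destruct F as [F hF], G as [G hG], s as [s n].
  unfold is_identity; simpl in *; intros H.
  assert (e : fobj F = fobj G).
  { apply functional_extensionality; intros a; destruct (H a) as [e _]; exact e. }
  destruct F as [F0 F1], G as [G0 G1]; simpl in *; subst G0.
  assert (es : s = fun a => idn (F0 a)).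
  { apply functional_extensionality_dep; intros a.
    destruct (H a) as [e E]; rewrite (proof_irrelevance _ e eq_refl) in E.
    exact E. }
  subst s.
  assert (e1 : F1 = G1).
  { do 3 (apply functional_extensionality_dep; intro).
    pose proof (n _ _ x1) as E; rewrite cmp_idl, cmp_idr in E.
    symmetry; exact E. }
  subst G1; assert (e : hF = hG) by apply proof_irrelevance; subst hG.
  exists eq_refl; apply NatTrans_eq; reflexivity.
Qed.

(** The identity of [A_p] is [p], and the two objects differ only in their idempotency proofs. This
    is the source of the strictness of [Kar]. *)
Lemma Kar_is_identity (C : Category) (a : C) (p : Hom a a) (h h' : p ∘ p = p)
    (f : @Hom (Kar C) (Build_KarOb h) (Build_KarOb h')) :
  proj1_sig f = p -> is_identity f.
Proof.
  assert (e : h = h') by apply proof_irrelevance; subst h'.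
  intros E; exists eq_refl; apply KarHom_eq; exact E.
Qed.

(** An idempotent [e] on [A_p] is already an idempotent of [C], so [A_e] splits it, with [e] serving
    both as [A_p -> A_e] and as [A_e -> A_p]. *)
Lemma Kar_ic (C : Category) : idempotent_complete (Kar C).
Proof.
  intros [a p hp] [e [ep pe]] ee; simpl in *.
  apply (f_equal (@proj1_sig _ _)) in ee; simpl in ee.
  exists {| kob := a; kidem := e; kidemP := ee |}.
  exists (exist _ e (conj ep ee)), (exist _ e (conj ee pe)).
  split; apply KarHom_eq; exact ee.
Qed.

Lemma fmor_comp (C D : Category) (F : Functor C D) (a b c : C) (g : Hom b c)
    (f : Hom a b) : fmor F (g ∘ f) = fmor F g ∘ fmor F f.
Proof. exact (fmor_cmp (functorP F) g f). Qed.

Lemma fmor_comp_eq (C D : Category) (F : Functor C D) (a b c : C) (g : Hom b c)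
    (f : Hom a b) (h : Hom a c) : g ∘ f = h -> fmor F g ∘ fmor F f = fmor F h.
Proof. intros E; rewrite <- E; symmetry; apply fmor_comp. Qed.

Lemma fmor_id (C D : Category) (F : Functor C D) (a : C) :
  fmor F (idn a) = idn (fobj F a).
Proof. exact (fmor_idn (functorP F) a). Qed.

(** Contracts a known composite at the head of a right-nested chain. *)
Lemma cmp_assocl (C : Category) (a b c : C) (g : Hom b c) (f : Hom a b)
    (h : Hom a c) :
  g ∘ f = h -> forall (d : C) (k : Hom d a), g ∘ (f ∘ k) = h ∘ k.
Proof. intros E d k; rewrite <- E; symmetry; apply cmp_assoc. Qed.

Lemma kar_idr (C : Category) (A B : KarOb C) (f : KarHom A B) :
  proj1_sig f ∘ kidem A = proj1_sig f.
Proof. exact (proj1 (proj2_sig f)). Qed.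

Lemma kar_idl (C : Category) (A B : KarOb C) (f : KarHom A B) :
  kidem B ∘ proj1_sig f = proj1_sig f.
Proof. exact (proj2 (proj2_sig f)). Qed.

(** * The strict 2-functor [Kar] *)

Definition Kar_pcomp (C D E : Category) (G : Functor D E) (F : Functor C D) :
  @Iso (FunCat (Kar C) (Kar E)) (comp_functor (Kar_functor G) (Kar_functor F))
       (Kar_functor (comp_functor G F)).
Proof.
  unshelve eapply nat_iso.
  - unshelve eexists.
    (* [G (F p)] is the idempotent of both image objects, hence their identity. *)
    + intros X; exists (fmor G (fmor F (kidem X))); simpl.
      rewrite <- !(fmor_cmp (functorP G)), <- !(fmor_cmp (functorP F)), !kidemP.
      split; reflexivity.
    + intros X Y f; apply KarHom_eq; simpl.
      rewrite <- !(fmor_cmp (functorP G)), <- !(fmor_cmp (functorP F)).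
      rewrite kar_idl, kar_idr; reflexivity.
  - intros X; exists (fmor G (fmor F (kidem X))); simpl.
    rewrite <- !(fmor_cmp (functorP G)), <- !(fmor_cmp (functorP F)), !kidemP.
    split; reflexivity.
  - intros X; apply KarHom_eq; simpl.
    rewrite <- !(fmor_cmp (functorP G)), <- !(fmor_cmp (functorP F)), !kidemP.
    reflexivity.
  - intros X; apply KarHom_eq; simpl.
    rewrite <- !(fmor_cmp (functorP G)), <- !(fmor_cmp (functorP F)), !kidemP.
    reflexivity.
Defined.

Definition Kar_punit (C : Category) :
  @Iso (FunCat (Kar C) (Kar C)) (id_functor (Kar C))
       (Kar_functor (id_functor C)).
Proof.
  unshelve eapply nat_iso.
  - unshelve eexists.
    + intros X; exists (kidem X); simpl; rewrite !kidemP; split; reflexivity.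
    + intros X Y f; apply KarHom_eq; simpl; rewrite kar_idl; apply kar_idr.
  - intros X; exists (kidem X); simpl; rewrite !kidemP; split; reflexivity.
  - intros X; apply KarHom_eq; apply kidemP.
  - intros X; apply KarHom_eq; apply kidemP.
Defined.

Definition Kar_pseudo : Pseudofunctor Cat Cat_ic.
Proof.
  refine (@Build_Pseudofunctor Cat Cat_ic (Kar_pmap Kar_ic) _ _
    (fun X Y Z g f => Kar_pcomp g f) (fun X => Kar_punit X) _ _ _ _);
  intros; apply NatTrans_eq; intros A; apply KarHom_eq; simpl.
  - apply cmp_idr.
  (* Naturality of [β] moves the inner copy of the idempotent outwards, where it merges with the
     outer one. *)
  - rewrite cmp_assoc, <- (cmp_assoc (β _)), <- nt_natural.
    rewrite <- !cmp_assoc, <- fmor_comp, kidemP; reflexivity.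
  - rewrite !cmp_assoc, <- fmor_comp, <- (nt_natural α).
    rewrite <- cmp_assoc, <- !fmor_comp, kidemP; reflexivity.
  - rewrite cmp_idr, <- !fmor_comp, !kidemP; reflexivity.
  (* The unitors of [Cat] match on the functor and compute only once it is destructed. *)
  - destruct f as [f hf]; simpl.
    rewrite cmp_idr, <- !(fmor_cmp hf), !kidemP; reflexivity.
  - destruct f as [f hf]; simpl.
    rewrite cmp_idr, <- !(fmor_cmp hf), !kidemP; reflexivity.
Defined.

Definition Kar_two : TwoFunctor Cat Cat_ic.
Proof.
  exists Kar_pseudo.
  - intros X Y Z g f; apply NatTrans_is_identity; intros A.
    apply Kar_is_identity; reflexivity.
  - intros X; apply NatTrans_is_identity; intros [a p hp].
    apply Kar_is_identity; reflexivity.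
Defined.

(** * The unit *)

Definition kar_embedding (C : Category) : Functor C (Kar C).
Proof.
  unshelve eexists.
  - exists (fun a => Build_KarOb (cmp_idl (idn a)) : Kar C).
    intros a b f; exists f; split; [apply cmp_idr | apply cmp_idl].
  - split; intros; apply KarHom_eq; reflexivity.
Defined.

(** On [F a] one composite carries the idempotent [F (id)], the other [id]. These agree only
    propositionally, so the cell is an explicit isomorphism over the identity. *)
Definition kar_unit2 (C D : Category) (F : Functor C D) :
  @Iso (FunCat C (Kar D)) (comp_functor (Kar_functor F) (kar_embedding C))
       (comp_functor (kar_embedding D) F).
Proof.
  unshelve eapply nat_iso.
  - unshelve eexists.
    + intros a; exists (idn (fobj F a)); simpl.
      rewrite fmor_id, cmp_idl; split; reflexivity.
    + intros a b f; apply KarHom_eq; simpl.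
      rewrite cmp_idl; apply cmp_idr.
  - intros a; exists (idn (fobj F a)); simpl.
    rewrite fmor_id, cmp_idl; split; reflexivity.
  - intros a; apply KarHom_eq; simpl.
    rewrite fmor_id; apply cmp_idl.
  - intros a; apply KarHom_eq; apply cmp_idl.
Defined.

Definition kar_unit : StrongTrans (id_pseudo Cat) (comp_pseudo U Kar_pseudo).
Proof.
  unshelve eapply (@Build_StrongTrans Cat Cat (id_pseudo Cat)
    (comp_pseudo U Kar_pseudo)
    (@Build_TransData Cat Cat (id_pseudo Cat) (comp_pseudo U Kar_pseudo)
       kar_embedding kar_unit2));
  intros; apply NatTrans_eq; intros a; apply KarHom_eq; simpl.
  - rewrite !fmor_id, !cmp_idl, !cmp_idr; reflexivity.
  - rewrite !cmp_idl; reflexivity.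
  - rewrite !fmor_id, !cmp_idl; reflexivity.
Defined.

(** * Splittings and the counit *)

Record Splitting (C : Category) (a : C) (p : Hom a a) := {
  spl : C;
  retr : Hom a spl;
  sect : Hom spl a;
  retr_sect : retr ∘ sect = idn spl;
  sect_retr : sect ∘ retr = p }.
Arguments spl {C a p} _.
Arguments retr {C a p} _.
Arguments sect {C a p} _.

(** Idempotent completeness only asserts existence, so a splitting is picked by choice. It stays
    opaque: later arguments rely on the splitting equations alone. *)
Definition splitting (C : Category) (hC : idempotent_complete C) (X : KarOb C) :
  Splitting (kidem X).
Proof.
  destruct (constructive_indefinite_description _ (hC _ _ (kidemP X)))
    as [B hB].
  destruct (constructive_indefinite_description _ hB) as [f hf].
  destruct (constructive_indefinite_description _ hf) as [g [fg gf]].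
  exists B f g; [exact fg | exact gf].
Qed.

Lemma retr_idem (C : Category) (a : C) (p : Hom a a) (s : Splitting p) :
  retr s ∘ p = retr s.
Proof.
  transitivity (retr s ∘ (sect s ∘ retr s)).
  - rewrite sect_retr; reflexivity.
  - rewrite <- cmp_assoc, retr_sect; apply cmp_idl.
Qed.

Lemma idem_sect (C : Category) (a : C) (p : Hom a a) (s : Splitting p) :
  p ∘ sect s = sect s.
Proof.
  transitivity (sect s ∘ retr s ∘ sect s).
  - rewrite sect_retr; reflexivity.
  - rewrite cmp_assoc, retr_sect; apply cmp_idr.
Qed.

Definition kar_realize (C : Category) (hC : idempotent_complete C) :
  Functor (Kar C) C.
Proof.
  unshelve eexists.
  - exists (fun X : Kar C => spl (splitting hC X)).
    intros X Y f.
    exact (retr (splitting hC Y) ∘ proj1_sig f ∘ sect (splitting hC X)).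
  - split; simpl.
    + intros X; rewrite retr_idem; apply retr_sect.
    + intros X Y Z g f.
      (* The inner [sect ∘ retr] is the idempotent of the middle object, which morphisms of [Kar C]
         absorb. *)
      rewrite !cmp_assoc, <- (cmp_assoc (sect _) (retr _)), sect_retr.
      rewrite <- (cmp_assoc (kidem Y)), kar_idl; reflexivity.
Defined.

(** [F] carries the chosen splitting of [p] to a splitting of [F p], which need not be the chosen
    one. The cell is the canonical comparison: section of the former, then retraction of the
    latter. *)
Definition kar_counit2 (C D : Category) (hC : idempotent_complete C)
    (hD : idempotent_complete D) (F : Functor C D) :
  @Iso (FunCat (Kar C) D) (comp_functor F (kar_realize hC))
       (comp_functor (kar_realize hD) (Kar_functor F)).
Proof.
  unshelve eapply nat_iso.
  - unshelve eexists.
    + intros X.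
      exact (retr (splitting hD (Kar_fob F X)) ∘ fmor F (sect (splitting hC X))).
    + intros X Y f; simpl.
      rewrite !fmor_comp, !cmp_assoc.
      rewrite <- (cmp_assoc (sect _)), sect_retr.
      rewrite <- (cmp_assoc (fmor F (sect _))), <- !fmor_comp, sect_retr.
      rewrite idem_sect, <- (cmp_assoc (kidem Y)), kar_idl; reflexivity.
  - intros X.
    exact (fmor F (retr (splitting hC X)) ∘ sect (splitting hD (Kar_fob F X))).
  - intros X; simpl.
    rewrite cmp_assoc, <- (cmp_assoc (sect _)), sect_retr.
    rewrite <- !fmor_comp, idem_sect, retr_sect; apply fmor_id.
  - intros X; simpl.
    rewrite cmp_assoc, <- (cmp_assoc (fmor F _)), <- fmor_comp, sect_retr.
    rewrite idem_sect; apply retr_sect.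
Defined.

Definition kar_counit : StrongTrans (comp_pseudo Kar_pseudo U) (id_pseudo Cat_ic).
Proof.
  unshelve eapply (@Build_StrongTrans Cat_ic Cat_ic (comp_pseudo Kar_pseudo U)
    (id_pseudo Cat_ic)
    (@Build_TransData Cat_ic Cat_ic (comp_pseudo Kar_pseudo U) (id_pseudo Cat_ic)
       (fun X => kar_realize (proj2_sig X))
       (fun X Y f => kar_counit2 (proj2_sig X) (proj2_sig Y) f)));
  intros; apply NatTrans_eq; intros A; simpl.
  - rewrite fmor_id, cmp_idr, cmp_idl, !cmp_assoc.
    rewrite <- (cmp_assoc (sect _)), sect_retr, <- fmor_comp, idem_sect.
    rewrite <- (nt_natural α), <- (cmp_assoc (fmor g (kidem A))).
    rewrite <- fmor_comp, idem_sect; reflexivity.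
  - rewrite !cmp_idl, !cmp_idr, kidemP, cmp_assoc, idem_sect; reflexivity.
  - rewrite !fmor_id, !cmp_idl, !cmp_idr, retr_idem, retr_sect, fmor_id, cmp_idr.
    rewrite !cmp_assoc, <- (fmor_comp g (sect _)).
    (* Inner pairs [sect ∘ retr] become idempotents, which the sections to their right absorb. *)
    do 2 rewrite <- (cmp_assoc (sect _) (retr _)), sect_retr.
    rewrite <- !fmor_comp, !idem_sect; reflexivity.
Defined.

(** * The triangle modifications *)

Lemma splitting_unique (C : Category) (a : C) (p : Hom a a) (s t : Splitting p) :
  (retr s ∘ sect t) ∘ (retr t ∘ sect s) = idn (spl s).
Proof.
  rewrite cmp_assoc, <- (cmp_assoc (sect t)), sect_retr, idem_sect.
  apply retr_sect.
Qed.

(** In [Kar C] the idempotent [p] on [A_id] splits canonically through [A_p], with [p] as both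
    retraction and section; the left triangle compares this with the chosen splitting. *)
Definition kar_splitting (C : Category) (X : KarOb C) :
  Splitting (kidem (Kar_fob (kar_embedding C) X)).
Proof.
  unshelve eexists.
  - exact X.
  - exists (kidem X); split; [apply cmp_idr | exact (kidemP X)].
  - exists (kidem X); split; [exact (kidemP X) | apply cmp_idl].
  - apply KarHom_eq; exact (kidemP X).
  - apply KarHom_eq; exact (kidemP X).
Defined.

Definition triangle_left (C : Category) :
  @Iso (FunCat (Kar C) (Kar C)) (id_functor (Kar C))
    (comp_functor (kar_realize (@Kar_ic C))
       (Kar_functor (kar_embedding C))).
Proof.
  pose (s X := splitting (@Kar_ic C) (Kar_fob (kar_embedding C) X)).
  unshelve eapply nat_iso.
  - exists (fun X => retr (s X) ∘ sect (kar_splitting X)).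
    intros X Y f.
    (* Unfolds the functors to a chain in [Kar C] in which [sect_retr] can be applied. *)
    change (retr (s Y) ∘ fmor (kar_embedding C) (proj1_sig f) ∘ sect (s X)
            ∘ (retr (s X) ∘ sect (kar_splitting X))
            = retr (s Y) ∘ sect (kar_splitting Y) ∘ f).
    rewrite !cmp_assoc, <- (cmp_assoc (sect _) (retr _)), sect_retr; f_equal.
    apply KarHom_eq; simpl.
    rewrite kidemP, kar_idl; apply kar_idr.
  - intros X; exact (retr (kar_splitting X) ∘ sect (s X)).
  - intros X; apply (splitting_unique (kar_splitting X) (s X)).
  - intros X; apply (splitting_unique (s X) (kar_splitting X)).
Defined.

Definition kar_triangle_left :
  @Modification Cat Cat_ic (Kar_pmap Kar_ic) (Kar_pmap Kar_ic)
    (id_trans (Kar_pmap Kar_ic))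
    (comp_trans (prewhisker kar_counit (Kar_pmap Kar_ic))
       (postwhisker Kar_pseudo kar_unit)).
Proof.
  exists (fun C : Category => iso_mor (triangle_left C)).
  intros C D F; apply NatTrans_eq; intros X; apply KarHom_eq; simpl.
  (* The chosen splittings become arbitrary ones: [s0] for the embedded [X], [s1] for the embedded
     [F X], [s2] for the image under [Kar F] of the embedded [X]. *)
  generalize (splitting (@Kar_ic C) (Kar_fob (kar_embedding C) X)).
  generalize (splitting (@Kar_ic D) (Kar_fob (kar_embedding D) (Kar_fob F X))).
  generalize (splitting (@Kar_ic D)
                (Kar_fob (Kar_functor F) (Kar_fob (kar_embedding C) X))).
  simpl; intros s2 s1 s0.
  pose proof (f_equal (@proj1_sig _ _) (sect_retr s0)) as E0.
  pose proof (f_equal (@proj1_sig _ _) (sect_retr s2)) as E2.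
  simpl in E0, E2.
  (* Contraction rules: [K0], [K1], [K2] absorb idempotents, [P] merges them, and [E0'], [E2']
     collapse a section after its retraction. *)
  pose proof (cmp_assocl (kar_idl (retr s1))) as K1.
  pose proof (cmp_assocl (kar_idl (retr s2))) as K2.
  pose proof (cmp_assocl (fmor_comp_eq F (kar_idr (sect s0)))) as K0.
  pose proof (cmp_assocl (fmor_comp_eq F (kidemP X))) as P.
  pose proof (cmp_assocl (fmor_comp_eq F E0)) as E0'.
  pose proof (cmp_assocl E2) as E2'.
  rewrite !fmor_comp, !cmp_assoc, !K1, K2, !K0, E2', !E0'; simpl.
  f_equal; rewrite cmp_idl, !P; reflexivity.
Defined.

(** In any splitting of [id_a], section and retraction are mutually inverse. *)
Definition triangle_right (C : Category) (hC : idempotent_complete C) :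
  @Iso (FunCat C C)
    (comp_functor (kar_realize hC) (kar_embedding C)) (id_functor C).
Proof.
  unshelve eapply nat_iso.
  - exists (fun a => sect (splitting hC (fobj (kar_embedding C) a))).
    intros a b f; simpl.
    rewrite <- !cmp_assoc, sect_retr; simpl; symmetry; f_equal; apply cmp_idl.
  - intros a; exact (retr (splitting hC (fobj (kar_embedding C) a))).
  - intros a; apply retr_sect.
  - intros a; apply sect_retr.
Defined.

(* The redundant identities make this convertible to the components of the
   modification axiom, where rewriting gets stuck on non-syntactic matches. *)
Lemma triangle_right_natural (C D : Category) (F : Functor C D) (a : C)
    (s0 : Splitting (idn a)) (s1 : Splitting (idn (fobj F a)))
    (s2 : Splitting (fmor F (idn a))) :
  (idn (fobj F a) ∘ idn (fobj F a)) ∘ (idn (fobj F a) ∘ fmor F (sect s0))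
  = sect s1 ∘ (retr s1 ∘ idn (fobj F a) ∘ sect s1)
    ∘ (idn _ ∘ (idn _ ∘ (retr s1 ∘ idn (fobj F a) ∘ sect s2)
      ∘ (idn _ ∘ (idn _ ∘ (retr s2 ∘ fmor F (sect s0) ∘ idn _)
         ∘ fmor F (retr s0 ∘ idn a ∘ sect s0) ∘ idn _)))).
Proof.
  rewrite !cmp_idl, !cmp_idr, !retr_sect, (fmor_id F (spl s0)), !cmp_idr.
  rewrite !cmp_assoc, <- (cmp_assoc (sect s2)), sect_retr, (fmor_id F a), cmp_idl.
  rewrite <- cmp_assoc, sect_retr, cmp_idl; reflexivity.
Qed.

Definition kar_triangle_right :
  @Modification Cat_ic Cat (forget_pmap (B := Cat) idempotent_complete)
    (forget_pmap (B := Cat) idempotent_complete)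
    (comp_trans (postwhisker U kar_counit) (prewhisker kar_unit U))
    (id_trans U).
Proof.
  exists (fun C : Cat_ic => iso_mor (triangle_right (proj2_sig C))).
  (* Destructing the functor lets the unitors in [id_trans] compute. *)
  intros C D [F hF]; apply NatTrans_eq; intros a.
  exact (triangle_right_natural (F := Build_Functor hF)
    (splitting (proj2_sig C) (fobj (kar_embedding _) a))
    (splitting (proj2_sig D) (fobj (kar_embedding _) (fobj F a)))
    (splitting (proj2_sig D)
       (Kar_fob (Build_Functor hF) (fobj (kar_embedding _) a)))).
Defined.

Theorem theorem2p10 :
  exists (Kar_ic : forall C : Category, idempotent_complete (Kar C))
         (K : TwoFunctor Cat Cat_ic),
    pmap K = Kar_pmap Kar_ic /\ left_adjoint K U.
Proof.
  exists Kar_ic, Kar_two; split; [reflexivity |].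
  exists kar_unit, kar_counit, kar_triangle_left, kar_triangle_right.
  split; intros C; apply iso_is_iso.
Qed.
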